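(* Let $k\in\mathbb{N}$ and let $f_1,\dots,f_k:\mathbb{N}\to\mathbb{R}$ be functions such that (1) the sequence $(\mathbf{x}_n)_{n\in\mathbb{N}}$ in $\mathbb{R}^k$ given by $\mathbf{x}_n:=(f_1(n),\dots,f_k(n))$ is totally-homogeneously equidistributed mod 1, and (2) $f_1$ is of the form $f_1(n)=\alpha n+\beta$ for some $\alpha,\beta\in\mathbb{R}$ with $\alpha$ irrational. Then the density below exists and $$\mathrm{dens}\big(\{n\in\mathbb{N}:\gcd(n,\lfloor f_1(n)\rfloor,\dots,\lfloor f_k(n)\rfloor)=1\}\big)=\frac{1}{\zeta(k+1)}.$$
   Context: $\mathbb{N}=\{1,2,3,\dots\}$; $\lfloor x\rfloor$ and $\{x\}=x-\lfloor x\rfloor\in[0,1)$ denote the integer and fractional parts of $x\in\mathbb{R}$, and $\{\mathbf{x}\}=(\{x_1\},\dots,\{x_k\})$ for $\mathbf{x}\in\mathbb{R}^k$; $\zeta$ is the Riemann zeta function. The density of $\mathcal{A}\subseteq\mathbb{N}$ is $\mathrm{dens}\,\mathcal{A}:=\lim_{N\to\infty}|\mathcal{A}\cap\{1,\dots,N\}|/N$, when this limit exists. A sequence $(\mathbf{x}_n)_{n\in\mathbb{N}}$ in $\mathbb{R}^k$ is equidistributed mod 1 if for every box $\mathcal{B}=[a_1,b_1)\times\cdots\times[a_k,b_k)\subseteq[0,1)^k$ one has $\mathrm{dens}(\{n\in\mathbb{N}:\{\mathbf{x}_n\}\in\mathcal{B}\})=(b_1-a_1)\cdots(b_k-a_k)$.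 It is totally-homogeneously equidistributed mod 1 if for all $D,b\in\mathbb{N}$ the sequence $\big(\frac{1}{D}\mathbf{x}_{Dn+b}\big)_{n\in\mathbb{N}}$ is equidistributed mod 1. *)

(* Defs.v *)
From mathcomp Require Export all_boot all_order all_algebra.
From mathcomp Require Export all_classical all_reals all_analysis.

Set Implicit Arguments.
Unset Strict Implicit.
Unset Printing Implicit Defensive.

Export Order.TTheory GRing.Theory Num.Theory.
Export numFieldNormedType.Exports.

Local Open Scope classical_set_scope.
Local Open Scope ring_scope.

(* The positive integers are represented inside [nat]: a sequence indexed by
   them is a function on [nat] whose value at 0 is never used, and a set of
   positive integers is a [set nat] of which only the positive elements count. *)

(* The density of A exists and equals d. *)
Definition has_density (R : realType) (A : set nat) (d : R) : Prop :=
  (fun N : nat => (count (mem A) (iota 1 N))%:R / N%:R : R) @ \oo --> d.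

Definition frac (R : realType) (x : R) : R := x - (Num.floor x)%:~R.

Definition equidistributed_mod1 (R : realType) (k : nat)
    (x : nat -> 'rV[R]_k) : Prop :=
  forall a b : 'rV[R]_k,
    (forall i, 0 <= a 0 i /\ a 0 i <= b 0 i /\ b 0 i <= 1) ->
    has_density
      [set n | forall i, a 0 i <= frac (x n 0 i) /\ frac (x n 0 i) < b 0 i]
      (\prod_(i < k) (b 0 i - a 0 i)).

Definition totally_homogeneously_equidistributed_mod1 (R : realType) (k : nat)
    (x : nat -> 'rV[R]_k) : Prop :=
  forall D b : nat, (0 < D)%N -> (0 < b)%N ->
    equidistributed_mod1 (fun n => D%:R^-1 *: x (D * n + b)%N).

(* The Riemann zeta function by its Dirichlet series
   1/1^s + 1/2^s + 1/3^s + ...; meaningful only for 1 < s. *)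
Definition zeta (R : realType) (s : R) : R := limn (series (riemannR s)).

(* Main.v *)
(* Write G(n) for the gcd in the theorem.  Equidistribution of (1/d) x_{dn+d} on the
   box [0,1/d)^k says that {n : d | G(n)} has density d^-(k+1), and inclusion-exclusion
   over the primes p <= z gives {n : no p <= z divides G(n)} the density
   prod_{p <= z} (1 - p^-(k+1)).  The same inclusion-exclusion for the weights
   n^-(k+1) / zeta(k+1), under which the multiples of d also have mass d^-(k+1), shows
   that this product tends to 1 / zeta(k+1).

   It remains to bound, uniformly in N, the number of n <= N for which
   g = gcd(n, floor(alpha n + beta)) is large.  Write n = g m and
   floor(alpha n + beta) = g l with l/m in lowest terms; then |alpha - l/m| <= C/n.
   For g of size 2^i and m of size 2^j, the fractions l/m are 4^-(j+1)-separated and lie in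
   an interval of length 2C/2^(i+j), so there are at most 8C 2^j + 2^i such n.  One has
   i + j <= log2 N, i is large by assumption, and j is large because alpha is irrational,
   so that summing over i and j gives a small multiple of N. *)
Require Import Defs.
From mathcomp Require Import lra ring zify.

Set Implicit Arguments.
Unset Strict Implicit.
Unset Printing Implicit Defensive.

Local Open Scope classical_set_scope.
Local Open Scope ring_scope.

(** * Inclusion-exclusion over a finite set of primes *)

Lemma count_divE (R : realType) (P : pred nat) (N : nat) :
  (count P (iota 1 N))%:R / N%:R = \sum_(1 <= n < N.+1 | P n) N%:R^-1 :> R.
Proof.
rewrite -sum1_count natr_sum mulr_suml /index_iota subSS subn0.
by under eq_bigr do rewrite mul1r.
Qed.

Lemma sum_multiples (R : nmodType) (F : nat -> R) (d N : nat) : (0 < d)%N ->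
  \sum_(1 <= n < N.+1 | (d %| n)%N) F n =
  \sum_(1 <= m < (N %/ d).+1) F (d * m)%N.
Proof.
move=> d0; elim: N => [|N IH]; first by rewrite div0n !big_geq.
rewrite big_mkcond big_nat_recr //= -big_mkcond /= IH divnS //.
case: ifPn => dN; last by rewrite addr0 add0n.
have qE : (N.+1 %/ d = (N %/ d).+1)%N by rewrite divnS // dN.
by rewrite add1n [RHS]big_nat_recr //= -qE mulnC divnK.
Qed.

Section Sieve.
Variables (R : realType) (s : nat) (w : nat -> nat -> R) (G : nat -> nat).

(** Induction on [ps]: adding a prime p removes from the indices counted for [e] those counted for
    [e * p], because p is coprime to [e]. This recursion is why [e] has to vary. The weights [w] are
    left arbitrary so that the sieve serves both 1/N and n^-s / zeta(s). *)
Lemma sieve_cvg (ps : seq nat) (e : nat) :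
  (forall d, (0 < d)%N ->
     (fun N => \sum_(1 <= n < N.+1 | (d %| G n)%N) w N n) @ \oo --> (d%:R ^- s : R)) ->
  uniq ps -> all prime ps -> (0 < e)%N -> all (coprime e) ps ->
  (fun N => \sum_(1 <= n < N.+1 | (e %| G n)%N &&
      all (fun p => ~~ (p %| G n)%N) ps) w N n) @ \oo -->
  (e%:R ^- s * \prod_(p <- ps) (1 - p%:R ^- s) : R).
Proof.
move=> dens; elim: ps e => [|p ps IH] e /=.
  move=> _ _ e0 _; rewrite big_nil mulr1.
  under eq_fun do under eq_bigl do rewrite andbT.
  exact: dens.
move=> /andP[pps ups] /andP[pp prs] e0 /andP[ep eps].
have H1 := IH e ups prs e0 eps.
have H2 : all (coprime (e * p)%N) ps.
  apply/allP => q qps; rewrite coprimeMl (allP eps _ qps) /=.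
  rewrite prime_coprime // dvdn_prime2 ?(allP prs q qps) //.
  by apply: contraNneq pps => ->.
have ep0 : (0 < e * p)%N by rewrite muln_gt0 e0 prime_gt0.
have H3 := IH (e * p)%N ups prs ep0 H2.
rewrite big_cons.
have -> : e%:R ^- s * ((1 - p%:R ^- s) * \prod_(q <- ps) (1 - q%:R ^- s)) =
  e%:R ^- s * \prod_(q <- ps) (1 - q%:R ^- s) -
  (e * p)%:R ^- s * \prod_(q <- ps) (1 - q%:R ^- s) :> R.
  by rewrite natrM exprMn invfM; ring.
apply: cvg_trans (cvgB H1 H3); apply: near_eq_cvg.
apply: nearW => N /=; apply/eqP; rewrite subr_eq; apply/eqP.
rewrite [LHS](bigID (fun n => p %| G n)%N) /= addrC; congr (_ + _).
  by apply: eq_bigl => n; case: (p %| G n)%N; rewrite !(andbT, andbF).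
by apply: eq_bigl => n; rewrite Gauss_dvd // -andbA [_ && (p %| _)%N]andbC andbA.
Qed.
End Sieve.

(** * The zeta series and the partial Euler products *)

Lemma sum_expV_le (R : realType) (s m N : nat) : (1 < s)%N -> (0 < m)%N ->
  \sum_(m.+1 <= n < N.+1) n%:R ^- s <= m%:R^-1 :> R.
Proof.
move=> s1 m0; have [Nm|mN] := leqP N m.
  by rewrite big_geq ?ltnS // invr_ge0 ler0n.
(* As s >= 2, the term is at most 1/(n(n+1)), and the sum telescopes. *)
have le_term n : (0 < n)%N -> n.+1%:R ^- s <= n%:R^-1 - n.+1%:R^-1 :> R.
  move=> n0; have n0R : 0 < n%:R :> R by rewrite ltr0n.
  have -> : n%:R^-1 - n.+1%:R^-1 = (n%:R * n.+1%:R)^-1 :> R.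
    by rewrite -natr1; field; rewrite !lt0r_neq0 // addr_gt0.
  rewrite lef_pV2 ?posrE ?exprn_gt0 ?mulr_gt0 ?ltr0n //.
  rewrite (@le_trans _ _ (n.+1%:R ^+ 2)) //.
    by rewrite expr2 ler_wpM2r ?ler0n // ler_nat.
  by rewrite ler_eXn2l // ?ltr1n // ler1n.
rewrite big_add1 /=.
apply: (@le_trans _ _ (\sum_(m <= n < N) (n%:R^-1 - n.+1%:R^-1))).
  by apply: ler_sum_nat => n /andP[mn _]; apply: le_term; apply: leq_trans mn.
rewrite (telescope_sumr_eq (fun n => - n%:R^-1)) ?(ltnW mN) //; last first.
  by move=> n _; rewrite opprK addrC.
by rewrite opprK gerDr oppr_le0 invr_ge0 ler0n.
Qed.

Lemma zeta_cvg (R : realType) (s : nat) : (1 < s)%N ->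
  (fun N => \sum_(1 <= n < N.+1) n%:R ^- s) @ \oo --> (zeta s%:R : R).
Proof.
move=> s1.
have -> : (fun N => \sum_(1 <= n < N.+1) n%:R ^- s) = series (riemannR (s%:R : R)).
  apply/funext => N; rewrite /series /= big_add1 /=.
  by apply: eq_bigr => i _; rewrite /riemannR powR_mulrn ?ler0n.
suff : cvgn (series (riemannR (s%:R : R))) by [].
apply: nondecreasing_is_cvgn.
  apply/nondecreasing_seqP => n; rewrite /series /= big_nat_recr //= lerDl.
  by rewrite invr_ge0 powR_ge0.
(* The bound 2 is the first term 1 plus a tail of at most 1, by [sum_expV_le] with m = 1. *)
exists 2 => _ [[|N] _ <-]; rewrite /series /=; first by rewrite big_geq // ler0n.
rewrite big_nat_recl //= /riemannR powR1 invr1 -[2]/(1 + 1) lerD2l.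
under eq_bigr do rewrite powR_mulrn ?ler0n //.
have := @sum_expV_le R s 1 N.+1 s1 isT; rewrite invr1; apply: le_trans.
by rewrite !big_add1 /=.
Qed.

Lemma zeta_ge1 (R : realType) (s : nat) : (1 < s)%N -> 1 <= zeta (s%:R : R).
Proof.
move=> s1; have H := @zeta_cvg R s s1.
rewrite -(cvg_lim _ H) //; apply: limr_ge; first by apply/cvg_ex; eexists; exact: H.
exists 1%N => // -[//|N] _; rewrite big_nat_recl // expr1n invr1 lerDl.
by apply: sumr_ge0 => i _; rewrite invr_ge0 exprn_ge0.
Qed.

Lemma divn_cvgy (d : nat) : (0 < d)%N -> (fun N => N %/ d)%N @ \oo --> \oo.
Proof.
move=> d0; apply/cvgnyPge => A; exists (A * d)%N => // N /= AN.
by rewrite leq_divRL.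
Qed.

Definition primes_upto (z : nat) : seq nat := [seq p <- iota 1 z | prime p].

Lemma sift_ge (z n : nat) : (0 < n)%N ->
  all (fun p => ~~ (p %| n)%N) (primes_upto z) -> n = 1%N \/ (z < n)%N.
Proof.
move=> n0 /allP H; have [->|n1] := eqVneq n 1%N; first by left.
right; rewrite ltnNge; apply/negP => nz.
have p2 : prime (pdiv n) by rewrite pdiv_prime // ltn_neqAle eq_sym n1.
suff /H : pdiv n \in primes_upto z by rewrite pdiv_dvd.
by rewrite mem_filter p2 mem_iota prime_gt0 //= add1n ltnS (leq_trans _ nz) // pdiv_leq.
Qed.

(* The sieve applied to the probability weights n^-s / zeta(s). *)
Lemma euler_product_le (R : realType) (s z : nat) : (1 < s)%N -> (0 < z)%N ->
  `|\prod_(p <- primes_upto z) (1 - p%:R ^- s) - 1 / zeta s%:R| <= z%:R^-1 :> R.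
Proof.
move=> s1 z0; set Z := zeta s%:R.
have Z1 : 1 <= Z by apply: zeta_ge1.
have Z0 : 0 < Z by apply: lt_le_trans Z1.
pose w (N n : nat) : R := n%:R ^- s / Z.
have dens d : (0 < d)%N ->
   (fun N => \sum_(1 <= n < N.+1 | (d %| n)%N) w N n) @ \oo --> (d%:R ^- s : R).
  move=> d0.
  have -> : (fun N => \sum_(1 <= n < N.+1 | (d %| n)%N) w N n) =
      (fun N => d%:R ^- s / Z * \sum_(1 <= m < (N %/ d).+1) m%:R ^- s).
    apply/funext => N; rewrite sum_multiples // mulr_sumr; apply: eq_bigr => m _.
    by rewrite /w natrM exprMn invfM mulrAC.
  rewrite -[X in _ --> X](divfK (lt0r_neq0 Z0)).
  apply: cvgM; first exact: cvg_cst.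
  exact: (cvg_comp _ _ (divn_cvgy d0) (@zeta_cvg R s s1)).
have ups : uniq (primes_upto z) by rewrite filter_uniq ?iota_uniq.
have prs : all prime (primes_upto z) by apply: filter_all.
have co1 : all (coprime 1) (primes_upto z) by apply/allP => p _; rewrite coprime1n.
have := @sieve_cvg R s w id (primes_upto z) 1 dens ups prs isT co1.
rewrite expr1n invr1 mul1r => H.
set P := \prod_(_ <- _) _ in H *.
have {}H : (fun N => `|\sum_(1 <= n < N.+1 | (1 %| n)%N &&
    all (fun p => ~~ (p %| n)%N) (primes_upto z)) w N n - 1 / Z|) @ \oo --> `|P - 1 / Z|.
  by apply: cvg_norm; apply: cvgB => //; apply: cvg_cst.
rewrite -(cvg_lim _ H) //; apply: limr_le; first by apply/cvg_ex; eexists; exact: H.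
exists 1%N => // -[//|N] _ /=.
(* The term n = 1 survives the sieve and cancels 1/Z exactly. *)
rewrite big_mkcond /= big_ltn // dvd1n /=.
have -> : all (fun p => ~~ (p %| 1)%N) (primes_upto z).
  by apply/allP => p pz; rewrite dvdn1; have := allP prs _ pz; case: eqP => // ->.
rewrite {1}/w expr1n invr1 addrAC subrr add0r -big_mkcond /=.
rewrite ger0_norm; last by apply: sumr_ge0 => n _; rewrite divr_ge0 // ?ltW // invr_ge0 exprn_ge0.
(* Every other survivor exceeds [z], and 1/Z <= 1, so the rest is at most the tail of the zeta
   series beyond [z]. *)
apply: (@le_trans _ _ (\sum_(z.+1 <= n < N.+2) n%:R ^- s)); last exact: sum_expV_le.
rewrite (@big_nat_widenl _ _ _ z.+1 2) // [leLHS]big_mkcond [leRHS]big_mkcond /=.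
apply: ler_sum_nat => n /andP[n2 _]; rewrite dvd1n /=.
case: ifPn => [/sift_ge|_]; last by case: ifP => // _; rewrite invr_ge0 exprn_ge0.
case=> [|n1|->]; [exact: ltnW|by rewrite n1 in n2|].
by rewrite /w ler_pdivrMr // ler_peMr // invr_ge0 exprn_ge0.
Qed.

(** * Densities under shift and dilation; divisibility of floors *)

Lemma invn_cvg0 (R : realType) : (fun N => N%:R^-1 : R) @ \oo --> (0 : R).
Proof. rewrite -cvg_shiftS; exact: cvg_harmonic. Qed.

Lemma divn_ratio_cvg (R : realType) (d : nat) : (0 < d)%N ->
  (fun N => (N %/ d)%:R / N%:R) @ \oo --> (d%:R^-1 : R).
Proof.
move=> d0; apply: (@squeeze_cvgr _ _ _ _ (fun N => d%:R^-1 - N%:R^-1) (fun=> d%:R^-1)).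
- exists 1%N => // N N0; have N0R : 0 < N%:R :> R by rewrite ltr0n.
  have d0R : 0 < d%:R :> R by rewrite ltr0n.
  apply/andP; split.
    rewrite lerBlDr -[X in _ + X]div1r -mulrDl ler_pdivlMr // mulrC ler_pdivrMr //.
    by rewrite natr1 -natrM ler_nat ltnW // ltn_ceil.
  rewrite ler_pdivrMr // mulrC ler_pdivlMr // -natrM ler_nat.
  exact: leq_divM.
- by rewrite -[X in _ --> X]subr0; apply: cvgB; [exact: cvg_cst|exact: invn_cvg0].
- exact: cvg_cst.
Qed.

(** The two counts differ only in the end terms [b 1] and [b N.+1], which is O(1/N) after
    division. *)
Lemma density_shift (R : realType) (b : pred nat) (a : R) :
  (fun N => \sum_(1 <= n < N.+1 | b n.+1) (N%:R^-1 : R)) @ \oo --> a ->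
  (fun N => \sum_(1 <= n < N.+1 | b n) (N%:R^-1 : R)) @ \oo --> a.
Proof.
move=> H; pose e N : R := ((b 1%N)%:R - (b N.+1)%:R) / N%:R.
have e0 : e @ \oo --> (0 : R).
  apply: (@squeeze_cvgr _ _ _ _ (fun N => - N%:R^-1) (fun N => N%:R^-1)).
  - apply: nearW => N; have N0 : 0 <= N%:R^-1 :> R by rewrite invr_ge0.
    by rewrite /e; case: (b 1%N); case: (b N.+1); rewrite /= ?mulr1n ?mulr0n ?subrr ?subr0 ?sub0r ?mulN1r ?mul1r ?mul0r; lra.
  - by rewrite -[X in _ --> X]oppr0; apply: cvgN; exact: invn_cvg0.
  - exact: invn_cvg0.
rewrite -[X in _ --> X]addr0; apply: cvg_trans (cvgD H e0); apply: near_eq_cvg.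
apply: nearW => N /=.
have cE (P : pred nat) : \sum_(1 <= n < N.+1 | P n) (N%:R^-1 : R) =
    (\sum_(1 <= n < N.+1) (P n)%:R) / N%:R.
  rewrite mulr_suml big_mkcond; apply: eq_bigr => n _.
  by case: (P n); rewrite ?mul1r ?mul0r.
rewrite !fctE /e !cE -mulrDl; congr (_ / _).
have E : (b 1%N)%:R + \sum_(1 <= n < N.+1) (b n.+1)%:R =
    \sum_(1 <= n < N.+1) (b n)%:R + (b N.+1)%:R :> R.
  rewrite -(@big_nat_recr _ _ _ N.+1 1 (fun n => (b n)%:R)) //.
  by rewrite ![in RHS]big_add1 big_add1 /= big_nat_recl.
by rewrite addrC -addrAC E addrK.
Qed.

Lemma density_dilate (R : realType) (d : nat) (b : pred nat) (a : R) : (0 < d)%N ->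
  (fun N => \sum_(1 <= n < N.+1 | b n) (N%:R^-1 : R)) @ \oo --> a ->
  (fun N => \sum_(1 <= n < N.+1 | (d %| n)%N && b (n %/ d)%N) (N%:R^-1 : R)) @ \oo --> a / d%:R.
Proof.
move=> d0 H; have {}H := cvg_comp _ _ (divn_cvgy d0) H.
rewrite mulrC; apply: cvg_trans (cvgM (@divn_ratio_cvg R d d0) H).
apply: near_eq_cvg; apply: nearW => N /=.
rewrite big_mkcondr sum_multiples // -big_mkcond /=.
under [RHS]eq_bigl do rewrite mulKn //.
have [->|M0] := posnP (N %/ d)%N; first by rewrite !big_geq // mulr0.
rewrite mulr_sumr; apply: eq_bigr => m _.
by rewrite mulrAC mulfV ?mul1r // pnatr_eq0 -lt0n.
Qed.

(** Write floor(x) = qd + r with 0 <= r < d. Then x - qd lies in [r, r+1), a part of [0, d), so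
    {x/d} = (x - qd)/d, and this is below 1/d exactly when r = 0. *)
Lemma dvdz_floor_frac (R : realType) (d : nat) (x : R) : (0 < d)%N ->
  (d%:Z %| Num.floor x)%Z = (0 <= frac (d%:R^-1 * x)) && (frac (d%:R^-1 * x) < d%:R^-1).
Proof.
move=> d0; have d0R : 0 < d%:R :> R by rewrite ltr0n.
set F := Num.floor x; set q := (F %/ d%:Z)%Z; set r := (F %% d%:Z)%Z.
have FE : F = q * d%:Z + r by exact: divz_eq.
have r0 : 0 <= r by rewrite modz_ge0 // eqz_nat -lt0n.
have rd : r < d%:Z by rewrite ltz_pmod.
have FR : F%:~R = q%:~R * d%:R + r%:~R :> R by rewrite FE rmorphD rmorphM.
have /andP[Fx xF] := floor_itv x; rewrite -/F in Fx xF.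
have r0R : 0 <= r%:~R :> R by rewrite ler0z.
have rdR : r%:~R + 1 <= d%:R :> R by rewrite -[1]/(1%:~R) -rmorphD -[d%:R]/(d%:Z%:~R) ler_int lezD1.
rewrite rmorphD /= in xF.
have -> : frac (d%:R^-1 * x) = (x - q%:~R * d%:R) / d%:R.
  rewrite /frac (_ : Num.floor _ = q); first by field; rewrite gt_eqF.
  apply: floor_def; rewrite mulrC ler_pdivlMr // ltr_pdivrMr // rmorphD /= mulrDl mul1r; lra.
rewrite divr_ge0 ?(ltW d0R) //; last lra.
rewrite -[X in _ < X]mul1r ltr_pM2r ?invr_gt0 //=.
rewrite (sameP dvdz_mod0P eqP) -/r; apply/eqP/idP => [r0'|xq]; first by rewrite r0' in FR; lra.
apply/eqP; rewrite eq_le r0 andbT -ltzD1 add0r.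
have : r%:~R < 1%:~R :> R by lra.
by rewrite ltr_int.
Qed.

(** * Rational approximation and the rarity of large gcds *)

Lemma irrational_gap (R : realType) (alpha : R) (t : nat) : irrational alpha ->
  exists2 delta : R, 0 < delta &
    forall (m : nat) (l : int), (0 < m < t)%N -> delta <= `|alpha * m%:R - l%:~R|.
Proof.
move=> irr; elim: t => [|t [delta d0 IH]]; first by exists 1 => // m l; rewrite ltn0 andbF.
have [->|t0] := eqVneq t 0%N; first by exists 1 => // m l; lia.
set x := alpha * t%:R.
have xZ (l : int) : x != l%:~R.
  apply/eqP => xl; apply: irr; exists (l%:Q / t%:Q) => //.
  rewrite fmorph_div /= ratr_int ratr_nat -xl mulfK // pnatr_eq0 //.
have /andP[fx xf] := floor_itv x.
have fx' : 0 < x - (Num.floor x)%:~R by rewrite subr_gt0 lt_neqAle eq_sym xZ.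
(* For the new multiplier t, every integer is at least as far from x as one of its two neighbours
   floor(x) and floor(x) + 1; both distances are positive by irrationality. *)
exists (Num.min delta (Num.min (x - (Num.floor x)%:~R) ((Num.floor x + 1)%:~R - x))).
  by rewrite !lt_min d0 fx' subr_gt0 xf.
move=> m l /andP[m0]; rewrite ltnS leq_eqVlt => /orP[/eqP->|mt]; last first.
  by apply: le_trans (IH m l _); rewrite ?ge_min ?lexx ?m0.
rewrite -/x !ge_min; apply/orP; right; have [lf|lf] := leP l (Num.floor x).
  apply/orP; left; apply: le_trans (ler_norm _); rewrite lerD2l lerN2.
  by rewrite ler_int.
apply/orP; right; rewrite distrC; apply: le_trans (ler_norm _); rewrite lerD2r.
by rewrite ler_int lezD1.
Qed.

(** Two geometric sums: over j <= L - i the powers add up to less than 2 * 2^(L-i), and summing this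
    over i >= s at most doubles its first value. *)
Lemma sum_dyadic_triangle (R : realType) (s t L : nat) :
  \sum_(s <= i < L.+1) \sum_(t <= j < L.+1 | (i + j <= L)%N) 2 ^+ j
    <= 4 * (2 ^+ L / 2 ^+ s) :> R.
Proof.
have p2 e : 0 < 2 ^+ e :> R by rewrite exprn_gt0.
apply: (@le_trans _ _ (\sum_(s <= i < L.+1) 2 * (2 ^+ L / 2 ^+ i))).
  apply: ler_sum_nat => i /andP[_]; rewrite ltnS => iL.
  rewrite (eq_bigl (fun j => (j < (L - i).+1)%N)); last by move=> j /=; lia.
  rewrite -(@big_nat_widen _ _ _ t _ _ predT) ?ltnS ?leq_subr //.
  have -> : 2 * (2 ^+ L / 2 ^+ i) = 2 ^+ (L - i).+1 :> R.
    rewrite exprS; congr (_ * _); rewrite -{1}(subnK iL) exprD mulfK // lt0r_neq0.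
  have [tL|tL] := leqP t (L - i).+1; last by rewrite big_geq ?(ltW (p2 _)) // ltnW.
  rewrite (telescope_sumr_eq (fun j => 2 ^+ j)) //; last by move=> j _; rewrite exprS; ring.
  by rewrite gerBl ltW.
have [sL|sL] := leqP s L.+1; last first.
  by rewrite big_geq ?(ltnW sL) // mulr_ge0 // divr_ge0 // ltW.
rewrite (telescope_sumr_eq (fun i => - (4 * (2 ^+ L / 2 ^+ i)))) //; last first.
  by move=> i _; rewrite [2 ^+ i.+1]exprS; field; rewrite lt0r_neq0.
by rewrite opprK gerDr oppr_le0 mulr_ge0 // divr_ge0 // ltW.
Qed.

Section Tail.
Variables (R : realType) (alpha C : R) (F : nat -> int).
Hypothesis FC : forall n, (0 < n)%N -> `|(F n)%:~R - alpha * n%:R| <= C.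
Let g n := `|gcdz n%:Z (F n)|%N.
Let m n := (n %/ g n)%N.
Let l n := (F n %/ (g n)%:Z)%Z.

Let g_gt0 n : (0 < n)%N -> (0 < g n)%N.
Proof. by move=> n0; rewrite /g absz_gt0 gcdz_eq0 negb_and eqz_nat -lt0n n0. Qed.

Let nE n : n = (m n * g n)%N.
Proof. by rewrite /m divnK // /g /gcdz /= dvdn_gcdl. Qed.

Let FE n : F n = l n * (g n)%:Z.
Proof. by rewrite /l divzK // dvdz_gcdr. Qed.

(** An index n of the block is determined by [g n] and the integer part of a rescaled l/m: there are
    2^i possible values of the former and at most 8C 2^j / 2^i + 1 of the latter. *)
Lemma dyadic_block_count (i j N : nat) :
  (count (fun n => (trunc_log 2 (g n) == i) && (trunc_log 2 (m n) == j)) (iota 1 N))%:R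
    <= 8 * C * 2 ^+ j + 2 ^+ i.
Proof.
(* On the block n >= 2^(i+j), so F(n)/n is within [c] of [alpha]. The factor 4 * 4^j in [u]
   stretches the spacing of the fractions l/m with m < 2^(j+1) beyond 1, and the length 2c becomes
   8C 2^j / 2^i. *)
pose c : R := C / (2 ^+ i * 2 ^+ j).
pose u n : R := 4 * (2 ^+ j) ^+ 2 * ((F n)%:~R / n%:R - alpha + c).
pose K := Num.truncn (8 * C * 2 ^+ j / 2 ^+ i).
set P := fun n => _; pose X := [seq n <- iota 1 N | P n].
have C0 : 0 <= C by apply: le_trans (FC (isT : 0 < 1)%N).
have p2 e : 0 < 2 ^+ e :> R by rewrite exprn_gt0.
have XP n : n \in X -> [/\ (0 < n)%N, (2 ^ i <= g n < 2 ^ i.+1)%N &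
   (2 ^ j <= m n < 2 ^ j.+1)%N].
  rewrite mem_filter mem_iota => /andP[/andP[/eqP gi /eqP mj] /andP[n0 _]].
  have m0 : (0 < m n)%N by move: n0; rewrite {1}(nE n) muln_gt0 => /andP[].
  by split=> //; [rewrite -gi|rewrite -mj]; apply: trunc_log_bounds => //; exact: g_gt0.
have u_bd n : n \in X -> 0 <= u n <= 8 * C * 2 ^+ j / 2 ^+ i.
  move=> /XP[n0 /andP[gi _] /andP[mj _]].
  have n0R : 0 < n%:R :> R by rewrite ltr0n.
  have nc : `|(F n)%:~R / n%:R - alpha| <= c.
    rewrite -[alpha](mulfK (lt0r_neq0 n0R)) -mulrBl normrM [`|_^-1|]gtr0_norm ?invr_gt0 //.
    apply: (@le_trans _ _ (C / n%:R)); first by rewrite ler_pM2r ?invr_gt0 // FC.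
    rewrite ler_wpM2l // lef_pV2 ?posrE ?mulr_gt0 //.
    by rewrite -!natrX -natrM ler_nat (nE n) mulnC leq_mul.
  have cE : 8 * C * 2 ^+ j / 2 ^+ i = 4 * (2 ^+ j) ^+ 2 * (c + c).
    by rewrite /c; field; rewrite !lt0r_neq0.
  move: nc; rewrite ler_norml => /andP[nc1 nc2].
  have q0 : 0 < 4 * (2 ^+ j) ^+ 2 :> R by rewrite mulr_gt0 // exprn_gt0.
  by rewrite cE /u; apply/andP; split; [apply: mulr_ge0|apply: ler_wpM2l]; (try exact: ltW); lra.
have phi_inj : {in X &, injective (fun n => (g n, Num.truncn (u n)))}.
  move=> n n' nX nX' [gg uu].
  have /andP[u0 _] := u_bd _ nX; have /andP[u0' _] := u_bd _ nX'.
  have /andP[a1 a2] := truncn_itv u0; have /andP[b1 b2] := truncn_itv u0'.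
  rewrite uu in a1 a2; rewrite -natr1 in a2 b2.
  have [n0 /andP[gi _] /andP[mj mj2]] := XP _ nX.
  have [n0' _ /andP[mj' mj2']] := XP _ nX'.
  have uE k : (0 < k)%N ->
      u k = 4 * (2 ^+ j) ^+ 2 * ((l k)%:~R / (m k)%:R - alpha + c).
    move=> k0; rewrite /u; congr (_ * (_ - _ + _)).
    have gk := g_gt0 k0.
    have mk : (0 < m k)%N by move: k0; rewrite {1}(nE k) muln_gt0 => /andP[].
    have FR : (F k)%:~R = (l k)%:~R * (g k)%:R :> R by rewrite FE rmorphM.
    have kR : k%:R = (m k)%:R * (g k)%:R :> R by rewrite -natrM -nE.
    by rewrite FR kR -mulf_div mulfV ?mulr1 // pnatr_eq0 -lt0n.
  have m0 : 0 < (m n)%:R :> R by rewrite ltr0n (leq_trans _ mj) // expn_gt0.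
  have m0' : 0 < (m n')%:R :> R by rewrite ltr0n (leq_trans _ mj') // expn_gt0.
  (* The integer l m' - l' m equals u - u', of size below 1, times m m' / (4 * 4^j), also below 1;
     hence it is 0. *)
  have lm : l n * (m n')%:Z = l n' * (m n)%:Z.
    apply/eqP; rewrite -subr_eq0 -normr_eq0 eq_le normr_ge0 andbT -ltzD1 add0r.
    rewrite -(ltr_int R) intr_norm rmorphB !rmorphM /=.
    have -> : (l n)%:~R * (m n')%:R - (l n')%:~R * (m n)%:R =
       (u n - u n') * ((m n)%:R * (m n')%:R / (4 * (2 ^+ j) ^+ 2)) :> R.
      by rewrite !uE //; field; rewrite !lt0r_neq0.
    have M2 : (m n)%:R * (m n')%:R < 4 * (2 ^+ j) ^+ 2 :> R.
      rewrite (_ : 4 * (2 ^+ j) ^+ 2 = 2 ^+ j.+1 * 2 ^+ j.+1); last by rewrite [2 ^+ j.+1]exprS; ring.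
      by rewrite ltr_pM ?ltW // -natrX ltr_nat.
    have Q0 : 0 < (m n)%:R * (m n')%:R / (4 * (2 ^+ j) ^+ 2) :> R.
      by rewrite divr_gt0 ?mulr_gt0 ?exprn_gt0.
    rewrite normrM (gtr0_norm Q0) -[ltRHS]mulr1 ltr_pM ?(ltW Q0) //.
      by rewrite ltr_norml; apply/andP; split; lra.
    by rewrite ltr_pdivrMr ?mul1r // mulr_gt0 // exprn_gt0.
  have Fn : F n * n'%:Z = F n' * n%:Z.
    have nZ k : k%:Z = (m k)%:Z * (g k)%:Z by rewrite -PoszM -nE.
    by rewrite [F n]FE [F n']FE [n%:Z]nZ [n'%:Z]nZ mulrACA lm gg [RHS]mulrACA.
  (* Both sides are the gcd of n n' and n' F(n) = n F(n'). As [g n] and [g n'] agree, n = n'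
     follows. *)
  have gE : n'%:Z * gcdz n%:Z (F n) = n%:Z * gcdz n'%:Z (F n').
    have := mulz_gcdr n'%:Z n%:Z (F n); have := mulz_gcdr n%:Z n'%:Z (F n').
    by rewrite !absz_nat => -> ->; rewrite [n'%:Z * n%:Z]mulrC [n'%:Z * F n]mulrC Fn [F n' * _]mulrC.
  have {}gE : (n' * g n = n * g n')%N by have := congr1 absz gE; rewrite !abszM.
  by apply/eqP; rewrite eq_sym -(eqn_pmul2r (g_gt0 n0)) gE gg.
have -> : count P (iota 1 N) = size [seq (g n, Num.truncn (u n)) | n <- X].
  by rewrite size_map size_filter.
have : (size [seq (g n, Num.truncn (u n)) | n <- X] <=
   size [seq (a, b) | a <- iota (2 ^ i) (2 ^ i), b <- iota 0 K.+1])%N.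
  apply: uniq_leq_size.
    by rewrite map_inj_in_uniq // filter_uniq // iota_uniq.
  move=> _ /mapP[n nX ->]; apply/allpairsP; exists (g n, Num.truncn (u n)).
  have [_ gb _] := XP _ nX; have /andP[u0 uK] := u_bd _ nX.
  split; last by [].
    by rewrite mem_iota addnn -mul2n -expnS.
  by rewrite mem_iota add0n ltnS /=; exact: le_truncn.
rewrite size_allpairs !size_iota -(ler_nat R) => /le_trans; apply.
have K0 : 0 <= 8 * C * 2 ^+ j / 2 ^+ i by rewrite !(mulr_ge0, divr_ge0) // ltW.
have /andP[KK _] := truncn_itv K0.
rewrite natrM natrX -[K.+1%:R]natr1 mulrDr mulr1 lerD2r mulrC -ler_pdivlMr //.
Qed.
(** The blocks that occur have i >= s, j >= t and i + j <= log2 N. Summing 8C 2^j + 2^i over them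
    gives 4 * 8C / 2^s and 4 / 2^t, each times 2^L <= N. *)
Lemma large_gcd_count (s t N : nat) : (0 < N)%N ->
  (forall n, (0 < n)%N -> (2 ^ s <= g n)%N -> (2 ^ t <= m n)%N) ->
  (count (fun n => (2 ^ s <= g n)%N) (iota 1 N))%:R
    <= (32 * C / 2 ^+ s + 4 / 2 ^+ t) * N%:R.
Proof.
move=> N0 gm; pose L := trunc_log 2 N.
have C0 : 0 <= C by apply: le_trans (FC (isT : 0 < 1)%N).
have p2 e : 0 < 2 ^+ e :> R by rewrite exprn_gt0.
pose b n i j : bool := (trunc_log 2 (g n) == i) && (trunc_log 2 (m n) == j).
have : (count (fun n => (2 ^ s <= g n)%N) (iota 1 N) <=
    \sum_(s <= i < L.+1) \sum_(t <= j < L.+1 | (i + j <= L)%N)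
      count (fun n => b n i j) (iota 1 N))%N.
  (* Each counted n is charged to its own pair of dyadic exponents. *)
  apply: (@leq_trans (\sum_(n <- iota 1 N) \sum_(s <= i < L.+1)
      \sum_(t <= j < L.+1 | (i + j <= L)%N) b n i j)%N); last first.
    rewrite exchange_big /=; apply: leq_sum => i _.
    rewrite exchange_big /=; apply: leq_sum => j _.
    by rewrite -sum1_count [leqRHS]big_mkcond.
  rewrite -sum1_count big_mkcond /= big_seq [leqRHS]big_seq.
  apply: leq_sum => n; rewrite mem_iota add1n ltnS => /andP[n0 nN].
  case: ifP => // gs; have mt := gm _ n0 gs.
  have g0 := g_gt0 n0; have m0 : (0 < m n)%N by apply: leq_trans mt; rewrite expn_gt0.
  have ijL : (trunc_log 2 (g n) + trunc_log 2 (m n) <= L)%N.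
    apply: trunc_log_max => //; rewrite expnD (leq_trans _ nN) // [leqRHS](nE n) mulnC.
    by rewrite leq_mul // trunc_logP.
  have si : (s <= trunc_log 2 (g n))%N by apply: trunc_log_max.
  have tj : (t <= trunc_log 2 (m n))%N by apply: trunc_log_max.
  rewrite (bigD1_seq (trunc_log 2 (g n))) ?iota_uniq //=; last by rewrite mem_index_iota; lia.
  rewrite big_mkcond (bigD1_seq (trunc_log 2 (m n))) ?iota_uniq //=; last by rewrite mem_index_iota; lia.
  by rewrite /b ijL !eqxx.
rewrite -(ler_nat R) => /le_trans; apply; rewrite natr_sum.
under eq_bigr do rewrite natr_sum.
apply: (@le_trans _ _ (\sum_(s <= i < L.+1) \sum_(t <= j < L.+1 | (i + j <= L)%N)
   (8 * C * 2 ^+ j + 2 ^+ i))).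
  by apply: ler_sum => i _; apply: ler_sum => j _; exact: dyadic_block_count.
under eq_bigr do rewrite big_split /= -mulr_sumr.
rewrite big_split /= -mulr_sumr [leRHS]mulrDl lerD //.
  apply: (@le_trans _ _ (8 * C * (4 * (2 ^+ L / 2 ^+ s)))).
    by rewrite ler_wpM2l ?mulr_ge0 // sum_dyadic_triangle.
  have -> : 8 * C * (4 * (2 ^+ L / 2 ^+ s)) = 32 * C / 2 ^+ s * 2 ^+ L by ring.
  rewrite ler_wpM2l ?mulr_ge0 ?invr_ge0 ?(ltW (p2 _)) //.
  by rewrite -natrX ler_nat trunc_logP.
under eq_bigr do rewrite big_mkcond.
(* The terms 2^i form the same triangle with i and j interchanged. *)
rewrite exchange_big /=.
under eq_bigr do (rewrite -big_mkcond /=; under eq_bigl do rewrite addnC).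
apply: le_trans (sum_dyadic_triangle _ _ _ _) _.
have -> : 4 * (2 ^+ L / 2 ^+ t) = 4 / 2 ^+ t * 2 ^+ L :> R by ring.
rewrite ler_wpM2l ?mulr_ge0 ?invr_ge0 ?(ltW (p2 _)) //.
by rewrite -natrX ler_nat trunc_logP.
Qed.

(** The order of choices is t, then the gap [delta] for denominators below 2^t, then s with C / 2^s
    < [delta]. If g >= 2^s then |alpha m - l| <= C/g < [delta], which forces m >= 2^t. *)
Lemma gcd_tail : irrational alpha -> forall e : R, 0 < e ->
  exists T : nat, forall N, (0 < N)%N ->
    (count (fun n => (T <= g n)%N) (iota 1 N))%:R <= e * N%:R.
Proof.
move=> irr e e0.
have C0 : 0 <= C by apply: le_trans (FC (isT : 0 < 1)%N).
have p2 k : 0 < 2 ^+ k :> R by rewrite exprn_gt0.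
have pow_big (x : R) : 0 < x -> forall y, exists k, forall k', (k <= k')%N -> y / 2 ^+ k' < x.
  move=> x0 y; exists (Num.bound (y / x)) => k' kk.
  by rewrite ltr_pdivrMr // mulrC -ltr_pdivrMr //; apply: upper_nthrootP.
have [t /(_ t (leqnn _)) te] := pow_big (e / 2) (divr_gt0 e0 (ltr0n _ 2)) 4.
have [delta d0 gap] := irrational_gap (2 ^ t) irr.
have [s1 s1P] := pow_big delta d0 C.
have [s2 s2P] := pow_big (e / 2) (divr_gt0 e0 (ltr0n _ 2)) (32 * C).
pose s := maxn s1 s2; exists (2 ^ s)%N => N N0.
apply: le_trans (large_gcd_count (t := t) N0 _) _; last first.
  rewrite ler_wpM2r // [leRHS](splitr e) lerD ?(ltW te) //.
  by rewrite ltW // s2P // leq_maxr.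
move=> n n0 gs; rewrite leqNgt; apply/negP => mt.
have m0 : (0 < m n)%N by move: n0; rewrite {1}(nE n) muln_gt0 => /andP[].
have := gap _ (l n) (introT andP (conj m0 mt)); apply/negP; rewrite -ltNge.
have g0 : 0 < (g n)%:R :> R by rewrite ltr0n g_gt0.
apply: le_lt_trans (s1P s (leq_maxl _ _)).
apply: (@le_trans _ _ (C / (g n)%:R)); last first.
  by rewrite ler_wpM2l // lef_pV2 ?posrE // -natrX ler_nat.
rewrite ler_pdivlMr // -(gtr0_norm g0) -normrM mulrBl -mulrA -natrM -nE.
by have := FC n0; rewrite {1}FE rmorphM distrC.
Qed.
End Tail.

(** * From equidistribution to the density of gcd 1 *)

Lemma has_densityE (R : realType) (A : set nat) (b : pred nat) (a : R) :
  (forall n, (0 < n)%N -> A n <-> b n) ->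
  has_density A a <-> (fun N => \sum_(1 <= n < N.+1 | b n) (N%:R^-1 : R)) @ \oo --> a.
Proof.
move=> Ab; rewrite /has_density.
suff -> : (fun N => (count (mem A) (iota 1 N))%:R / N%:R) =
  (fun N => \sum_(1 <= n < N.+1 | b n) (N%:R^-1 : R)) by [].
apply/funext => N; rewrite -count_divE; congr (_%:R / _); apply: eq_in_count => n.
rewrite mem_iota => /andP[n0 _]; apply/idP/idP => [|bn].
  by rewrite /= in_setE => /Ab; apply.
by rewrite /= in_setE; apply/Ab.
Qed.

Lemma dvdz_biggcd (k d : nat) (F : 'I_k -> int) :
  (d%:Z %| \big[gcdz/0]_(i < k) F i)%Z = [forall i, (d%:Z %| F i)%Z].
Proof.
rewrite (big_morph (fun x => d%:Z %| x)%Z (dvdz_gcd d%:Z) (dvdz0 _)) big_andE.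
exact: eq_forallb.
Qed.

Lemma density_common_divisor (R : realType) (k : nat) (f : 'I_k -> nat -> R) (d : nat) :
  totally_homogeneously_equidistributed_mod1 (fun n => \row_(i < k) f i n) ->
  (0 < d)%N ->
  (fun N => \sum_(1 <= n < N.+1 |
     (d %| absz (gcdz n%:Z (\big[gcdz/0%R]_(i < k) Num.floor (f i n))))%N) (N%:R^-1 : R))
    @ \oo --> (d%:R ^- k.+1 : R).
Proof.
move=> hequi d0; have d0R : 0 < d%:R :> R by rewrite ltr0n.
have d1 : d%:R^-1 <= 1 :> R by rewrite invf_le1 // ler1n.
pose b n := [forall i, (d%:Z %| Num.floor (f i (d * n)%N))%Z].
(* The offset must be positive, so it is taken equal to d: the indices are d(n+1), and
   [density_shift] undoes the shift. The box has volume d^-k; the last factor 1/d comes from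
   [density_dilate]. *)
have := hequi d d d0 d0 0 (const_mx d%:R^-1).
under eq_bigr do rewrite !mxE subr0.
rewrite prodr_const card_ord => /(_ _) H.
have {}H : (fun N => \sum_(1 <= n < N.+1 | b n.+1) (N%:R^-1 : R)) @ \oo --> (d%:R^-1 ^+ k : R).
  apply/has_densityE; last first.
    by apply: H => i; rewrite !mxE invr_ge0 ler0n.
  move=> n n0 /=; rewrite /b; split => [H1|/forallP H1 i].
    apply/forallP => i; have := H1 i; rewrite !mxE -mulnSr => -[h1 h2].
    by rewrite dvdz_floor_frac // h1 h2.
  by have := H1 i; rewrite dvdz_floor_frac // !mxE -mulnSr => /andP.
have {}H := density_dilate d0 (density_shift H).
rewrite exprSr invfM -exprVn.
apply: cvg_trans H; apply: near_eq_cvg; apply: nearW => N.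
apply: eq_bigl => n.
have dE x : (d %| absz x)%N = (d%:Z %| x)%Z by rewrite dvdzE.
rewrite dE dvdz_gcd dvdz_biggcd /b -dE /=.
by case: (boolP (d %| n)%N) => //= dn; rewrite mulnC divnK.
Qed.

Theorem theorem1p1 (R : realType) (k : nat) (hk : (0 < k)%N)
    (f : 'I_k -> nat -> R)
    (hequi : totally_homogeneously_equidistributed_mod1
               (fun n => \row_(i < k) f i n))
    (hf1 : exists alpha beta : R, irrational alpha /\
             forall n : nat, (0 < n)%N ->
               f (Ordinal hk) n = alpha * n%:R + beta) :
  has_density
    [set n : nat | gcdz n%:Z (\big[gcdz/0]_(i < k) Num.floor (f i n)) = 1]
    (1 / zeta (k.+1%:R : R)).
Proof.
have [alpha [beta [irr f1E]]] := hf1.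
pose G n := absz (gcdz n%:Z (\big[gcdz/0]_(i < k) Num.floor (f i n))).
pose F n := Num.floor (f (Ordinal hk) n).
have FC n : (0 < n)%N -> `|(F n)%:~R - alpha * n%:R| <= 1 + `|beta|.
  move=> n0; have /andP[] := floor_itv (f (Ordinal hk) n).
  rewrite -/(F n) rmorphD /= f1E // => h1 h2.
  have /andP[b1 b2] : - `|beta| <= beta <= `|beta| by rewrite -ler_norml.
  by rewrite ler_norml; apply/andP; split; lra.
have G0 n : (0 < n)%N -> (0 < G n)%N.
  by move=> n0; rewrite /G absz_gt0 gcdz_eq0 negb_and eqz_nat -lt0n n0.
(* A large full gcd forces a large gcd with the linear function alone, to which [gcd_tail]
   applies. *)
have GF n : (0 < n)%N -> (G n <= `|gcdz n%:Z (F n)|)%N.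
  move=> n0; apply: dvdn_leq.
    by rewrite absz_gt0 gcdz_eq0 negb_and eqz_nat -lt0n n0.
  suff : ((G n)%:Z %| gcdz n%:Z (F n))%Z by rewrite dvdzE.
  rewrite dvdz_gcd.
  have : ((G n)%:Z %| gcdz n%:Z (\big[gcdz/0]_(i < k) Num.floor (f i n)))%Z by exact: dvdnn.
  by rewrite dvdz_gcd dvdz_biggcd => /andP[-> /forallP ->].
apply/(@has_densityE _ _ (fun n => G n == 1%N)).
  by move=> n n0 /=; rewrite /G; split=> [->//|/eqP]; rewrite /gcdz /= => ->.
apply/cvgrPdist_le => e e0.
have e3 : 0 < e / 3 by rewrite divr_gt0.
have [T TP] := gcd_tail FC irr e3.
(* z >= T puts sieve survivors with G(n) > z into the tail; z > 3/e makes the Euler product error at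
   most e/3. *)
pose z := maxn T (Num.bound (3 / e)).+1.
have z0 : (0 < z)%N by rewrite /z leq_max orbT.
have ze : z%:R^-1 <= e / 3.
  rewrite -[e / 3]invrK lef_pV2 ?posrE ?invr_gt0 ?ltr0n // invf_div.
  apply: (@le_trans _ _ (Num.bound (3 / e)).+1%:R); last by rewrite ler_nat leq_maxr.
  by rewrite ltW // (lt_le_trans (archi_boundP _)) ?divr_ge0 ?(ltW e0) // ler_nat.
have ups : uniq (primes_upto z) by rewrite filter_uniq ?iota_uniq.
have prs : all prime (primes_upto z) by apply: filter_all.
have co1 : all (coprime 1) (primes_upto z) by apply/allP => p _; rewrite coprime1n.
have := @sieve_cvg R k.+1 (fun N _ => N%:R^-1) G _ 1
  (fun d => density_common_divisor hequi) ups prs isT co1.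
rewrite expr1n invr1 mul1r => /cvgrPdist_le /(_ _ e3) H.
(* [hk] serves as 1 < k+1, to which 0 < k is convertible. *)
have := @euler_product_le R k.+1 z hk z0 => /le_trans /(_ ze) H2.
near=> N.
have N0 : (0 < N)%N by near: N; exists 1%N.
have H1 : `|\prod_(p <- primes_upto z) (1 - p%:R ^- k.+1) -
  \sum_(1 <= n < N.+1 | (1 %| G n)%N && all (fun p => ~~ (p %| G n)%N) (primes_upto z))
  N%:R^-1| <= e / 3 by near: N; exact: H.
have N0R : 0 < N%:R :> R by rewrite ltr0n.
have := TP N N0; rewrite -ler_pdivrMr // count_divE => H3.
(* [S1] and [S2] enclose the sifted count between the count of G(n) = 1 and that count plus the
   tail; the sieve, Euler product and tail errors are e/3 each. *)
have S1 : \sum_(1 <= n < N.+1 | G n == 1%N) N%:R^-1 <=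
  \sum_(1 <= n < N.+1 | (1 %| G n)%N && all (fun p => ~~ (p %| G n)%N) (primes_upto z)) N%:R^-1 :> R.
  rewrite big_mkcond [leRHS]big_mkcond; apply: ler_sum_nat => n _.
  case: eqP => [->|_]; last by case: ifP => // _; rewrite invr_ge0.
  case: ifPn => // /negP[]; rewrite dvd1n; apply/allP => p pz.
  by rewrite dvdn1; have := allP prs _ pz; case: eqP => // ->.
have S2 : \sum_(1 <= n < N.+1 | (1 %| G n)%N && all (fun p => ~~ (p %| G n)%N) (primes_upto z)) N%:R^-1
  <= \sum_(1 <= n < N.+1 | G n == 1%N) N%:R^-1 + 
  \sum_(1 <= n < N.+1 | (T <= `|gcdz n%:Z (F n)|)%N) N%:R^-1 :> R.
  rewrite big_mkcond [X in _ <= X + _]big_mkcond [X in _ <= _ + X]big_mkcond -big_split /=.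
  apply: ler_sum_nat => n /andP[n0 _]; have Ni : 0 <= N%:R^-1 :> R by rewrite invr_ge0.
  case: ifPn => [/andP[_ /(sift_ge (G0 _ n0))]|_]; last first.
    by rewrite addr_ge0 //; case: ifP.
  case=> [->|zG]; first by rewrite eqxx lerDl; case: ifP.
  rewrite (_ : (T <= _)%N) ?lerDr; first by case: ifP.
  by apply: leq_trans (GF _ n0); apply: leq_trans (ltnW zG); apply: leq_maxl.
move: H1 H2; rewrite !ler_norml => /andP[? ?] /andP[? ?].
by apply/andP; split; lra.
Unshelve. all: by end_near.
Qed.
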